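(* Each $(\mathbb{Z},4)$-Ramsey ultrafilter $\mathcal{U}$ on $\mathbb{Z}$ is selective.
   Context: An ultrafilter is free if it is non-principal. For $n\geqslant 2$, $[\mathbb{Z}]^n$ denotes the set of $n$-element subsets of $\mathbb{Z}$, and $\mathbb{Z}$ acts on itself by translations. A coloring $\chi:[\mathbb{Z}]^n\to\{0,1\}$ is $\mathbb{Z}$-invariant if $\chi(\{x_1,\ldots,x_n\})=\chi(\{g+x_1,\ldots,g+x_n\})$ for all $\{x_1,\ldots,x_n\}\in[\mathbb{Z}]^n$ and $g\in\mathbb{Z}$. A free ultrafilter $\mathcal{U}$ on $\mathbb{Z}$ is $(\mathbb{Z},n)$-Ramsey if, for every $\mathbb{Z}$-invariant coloring $\chi:[\mathbb{Z}]^n\to\{0,1\}$, there exists $U\in\mathcal{U}$ such that $\chi$ is constant on $[U]^n$. A free ultrafilter $\mathcal{U}$ on an infinite set $X$ is selective if, for any partition $\mathcal{P}$ of $X$, either one cell of $\mathcal{P}$ is a member of $\mathcal{U}$, or some member of $\mathcal{U}$ meets each cell of $\mathcal{P}$ in at most one point. *)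

(* Defs.v *)
From mathcomp Require Import all_boot all_order all_algebra finmap.
From mathcomp Require Import boolp classical_sets filter.

Set Implicit Arguments.
Unset Strict Implicit.
Unset Printing Implicit Defensive.

Import GRing.Theory.

Local Open Scope classical_set_scope.
Local Open Scope ring_scope.

Definition free_ultrafilter (T : Type) (U : set_system T) : Prop :=
  UltraFilter U /\ ~ (exists x : T, U = principal_filter x).

(* [A]^n *)
Definition nsubsets (T : choiceType) (n : nat) (A : set T) : set {fset T} :=
  [set X : {fset T} | #|` X| = n /\ [set` X] `<=` A].

Definition translate (g : int) (X : {fset int}) : {fset int} :=
  [fset (g + x)%R | x in X]%fset.

(* A coloring of [Z]^n is represented by a function on all finite subsets of Z;
   only its values on [Z]^n are ever used. *)
Definition Z_invariant (n : nat) (chi : {fset int} -> bool) : Prop :=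
  forall X, nsubsets n setT X -> forall g : int, chi (translate g X) = chi X.

Definition Z_Ramsey (n : nat) (U : set_system int) : Prop :=
  free_ultrafilter U /\
  forall chi : {fset int} -> bool, Z_invariant n chi ->
    exists2 A, U A & exists c : bool, forall X, nsubsets n A X -> chi X = c.

(* A partition is a set P of cells, i.e. the family indexed by P via id. *)
Definition selective (T : Type) (U : set_system T) : Prop :=
  free_ultrafilter U /\
  forall P : set (set T), partition P id setT ->
    (exists2 C, P C & U C) \/
    (exists2 A, U A & forall C, P C -> is_subset1 (A `&` C)).

(* Main.v *)
Require Import Defs.
From mathcomp Require Import all_boot all_order all_algebra finmap.
From mathcomp Require Import boolp classical_sets filter.
From mathcomp Require Import zify.

Set Implicit Arguments.
Unset Strict Implicit.
Unset Printing Implicit Defensive.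

Import GRing.Theory.

Local Open Scope classical_set_scope.
Local Open Scope ring_scope.

(** The coloring of 4-subsets according to whether they can be written as
   {a, b, c, d} with a + b = c + d is invariant, and an infinite set cannot have
   all its 4-subsets of this form; so U has a member A without such 4-subsets.
   Two different translates of a 4-set cannot both lie in A, hence every coloring
   of [A]^4 extends to an invariant one, and U is Ramsey for all colorings of
   4-sets.  Selectivity follows by asking whether a 4-set has two
   points in a common cell. *)

Lemma nsubsets_seq (T : choiceType) (A : set T) (s : seq T) :
  uniq s -> {in s, forall x, A x} -> nsubsets (size s) A [fset x in s]%fset.
Proof.
move=> s_uniq sA; split; first by rewrite card_fseq undup_id.
by move=> x /=; rewrite inE; exact: sA.
Qed.

Lemma fset_exists_notin (T : choiceType) (X : {fset T}) (s : seq T) :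
  (size s < #|` X|)%N -> exists2 x, x \in X & x \notin s.
Proof.
move=> lt_sX; apply: contrapT => noX.
have : (X `<=` [fset x in s])%fset.
  apply/fsubsetP => x xX; rewrite inE; apply: contrapT => /negP xs.
  by apply: noX; exists x.
move=> /fsubset_leq_card; rewrite card_fseq leqNgt => /negP; apply.
exact: leq_ltn_trans (size_undup s) lt_sX.
Qed.

(** If [U] contained a singleton [[set x]], it would contain the principal filter at [x], hence
    equal it by maximality. So each point can be removed in turn. *)
Lemma free_ultrafilter_cofinite (T : eqType) (U : set_system T) (s : seq T) :
  free_ultrafilter U -> U [set y | y \notin s].
Proof.
move=> [UU Ufree]; elim: s => [|x s IHs]; first exact: filterS filterT.
have Ux : U (~` [set x]).
  have [Ux|//] := in_ultra_setVsetC [set x] UU.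
  exfalso; apply: Ufree; exists x.
  have xU := principal_filter_ultra x; apply: max_filter => B /=.
  by move/principal_filterP => Bx; apply: filterS Ux => _ ->.
apply: filterS (filterI Ux IHs) => y /= [/eqP yx ys].
by rewrite inE negb_or yx.
Qed.

(** Greedy choice: after picking [x] in [A], continue inside [A] intersected with the [r]-successors
    of [x], which is still in [U]. *)
Lemma filter_pairwise (T : eqType) (U : set_system T) (r : rel T) (n : nat)
    (A : set T) :
  ProperFilter U -> (forall x, U [set y | r x y]) -> U A ->
  exists s, [/\ size s = n, {in s, forall x, A x} & pairwise r s].
Proof.
move=> UF Ur; elim: n A => [|n IHn] A UA; first by exists [::].
have [x Ax] := filter_ex UA.
have [s [sz sA rs]] := IHn _ (filterI UA (Ur x)).
exists (x :: s); split; first by rewrite /= sz.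
- by move=> y; rewrite inE => /orP[/eqP -> //|/sA[]].
- by rewrite /= rs andbT; apply/allP => y /sA[].
Qed.

Lemma translateD (g h : int) (X : {fset int}) :
  translate g (translate h X) = translate (g + h) X.
Proof.
apply/fsetP => y; apply/imfsetP/imfsetP => /= [[_ /imfsetP[x xX ->] ->]|[x xX ->]].
  by exists x => //; rewrite addrA.
by exists (h + x); [apply/imfsetP; exists x|rewrite addrA].
Qed.

Lemma translate0 (X : {fset int}) : translate 0 X = X.
Proof.
apply/fsetP => y; apply/imfsetP/idP => /= [[x xX ->]|yX]; first by rewrite add0r.
by exists y; rewrite ?add0r.
Qed.

Lemma mem_translate (g x : int) (X : {fset int}) :
  x \in X -> g + x \in translate g X.
Proof. by move=> xX; apply/imfsetP; exists x. Qed.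

Lemma card_translate (g : int) (X : {fset int}) : #|` translate g X| = #|` X|.
Proof. by apply: card_imfset => /=; exact: addrI. Qed.

(** These are the weak Sidon sets: the four points must be distinct, so three-term progressions are
    allowed. *)
Definition sidon4 (A : set int) : Prop :=
  forall a b c d, A a -> A b -> A c -> A d ->
    uniq [:: a; b; c; d] -> a + b != c + d.

Definition additive4 (X : {fset int}) : Prop := ~ sidon4 [set` X].

Lemma additive4P (X : {fset int}) :
  additive4 X <-> exists a b c d, [/\ [/\ a \in X, b \in X, c \in X & d \in X],
    uniq [:: a; b; c; d] & a + b = c + d].
Proof.
split=> [|[a [b [c [d [[aX bX cX dX] u e]]]]] sX]; last first.
  by have := sX _ _ _ _ aX bX cX dX u; rewrite e eqxx.
move=> nX; apply: contrapT => nex; apply: nX => a b c d aX bX cX dX u.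
by apply/eqP => e; apply: nex; exists a, b, c, d.
Qed.

Lemma additive4_translate (g : int) (X : {fset int}) :
  additive4 X -> additive4 (translate g X).
Proof.
move=> /additive4P[a [b [c [d [[aX bX cX dX] u e]]]]]; apply/additive4P.
exists (g + a), (g + b), (g + c), (g + d); split.
- by split; exact: mem_translate.
- by rewrite -[X in uniq X]/(map (+%R g) [:: a; b; c; d]) map_inj_uniq //; exact: addrI.
- lia.
Qed.

Lemma Z_Ramsey4_sidon (U : set_system int) :
  Z_Ramsey 4 U -> exists2 A, U A & sidon4 A.
Proof.
move=> [Ufree URamsey]; have [UU _] := Ufree.
have cofin s := free_ultrafilter_cofinite s Ufree.
case: (URamsey (fun X => `[< additive4 X >])) => [X _ g|A UA [c Ac]].
  apply/asboolP/asboolP => [|]; last exact: additive4_translate.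
  by move=> /(@additive4_translate (- g)); rewrite translateD addNr translate0.
exists A => // a b p q Aa Ab Ap Aq u; apply/negP => /eqP e.
have c_true : c = true.
  rewrite -(Ac [fset x in [:: a; b; p; q]]%fset).
    apply/asboolP/additive4P; exists a, b, p, q; split=> //.
    by split; rewrite !inE eqxx ?orbT.
  by apply: nsubsets_seq => // x; rewrite !inE => /or4P[] /eqP ->.
(* A 4-set splits into two pairs in three ways. The last three excluded values are the solutions [w]
   of the three resulting equations, so [{a, b, p, w}] is not additive. *)
have [w [Aw]] := filter_ex
  (filterI UA (cofin [:: a; b; p; a + b - p; a + p - b; b + p - a])).
rewrite /= !inE !negb_or => /and5P[wa wb wp w1 /andP[w2 w3]].
move: (u); rewrite /= !inE !negb_or => /and4P[/and3P[ab ap _] /andP[bp _] _ _].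
have /Ac : nsubsets 4 A [fset x in [:: a; b; p; w]]%fset.
  apply: nsubsets_seq => [|x]; last by rewrite !inE => /or4P[] /eqP ->.
  by rewrite /= !inE !negb_or ab ap bp ![_ == w]eq_sym wa wb wp.
rewrite c_true => /asboolP/additive4P[x [y [z [t [[]]]]]].
rewrite !inE ?orbF; clear -w1 w2 w3.
move=> /or4P[] /eqP -> /or4P[] /eqP -> /or4P[] /eqP -> /or4P[] /eqP ->;
  rewrite /= !inE ?eqxx ?orbT ?andbF //= => _ he; lia.
Qed.

(** For [x], [y] in [X] the identity [x + (g + y) = y + (g + x)] is an additive relation inside [A],
    forbidden once its four points are distinct. *)
Lemma sidon4_rigid (A : set int) (g : int) (X : {fset int}) :
  sidon4 A -> nsubsets 4 A X -> [set` translate g X] `<=` A -> g = 0.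
Proof.
move=> sA [Xcard XA] gXA; apply: contrapT => g0.
have [|x xX _] := @fset_exists_notin _ X [::]; first by rewrite Xcard.
(* With [g] nonzero, these are the only values of [y] making two of the four points coincide; [X]
   has a fourth element to offer. *)
have [|y yX] := @fset_exists_notin _ X [:: x; g + x; x - g].
  by rewrite Xcard.
rewrite !inE !negb_or => /and3P[yx ygx yxg].
have := sA x (g + y) y (g + x) (XA _ xX) (gXA _ (mem_translate _ yX))
  (XA _ yX) (gXA _ (mem_translate _ xX)).
rewrite /= !inE !negb_or; lia.
Qed.

Lemma Z_Ramsey4_Ramsey (U : set_system int) (chi : {fset int} -> bool) :
  Z_Ramsey 4 U ->
  exists2 A, U A & exists c : bool, forall X, nsubsets 4 A X -> chi X = c.
Proof.
move=> UR; have [A UA sA] := Z_Ramsey4_sidon UR.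
have [[UU _] URamsey] := UR.
(* Invariant by construction; by rigidity the only translate of a 4-subset of [A] that lies in [A]
   is itself, so there [ext] agrees with [chi]. *)
pose ext X := `[< exists g, [set` translate g X] `<=` A /\ chi (translate g X) >].
case: (URamsey ext) => [X _ g|B UB [c Bc]].
  apply/asboolP/asboolP => -[h]; first by rewrite translateD; exists (h + g).
  by move=> hX; exists (h - g); rewrite translateD subrK.
exists (A `&` B); first exact: filterI.
exists c => X [Xcard XAB].
have XA : nsubsets 4 A X by split=> // x /XAB[].
rewrite -(Bc X); last by split=> // x /XAB[].
apply/idP/asboolP => [chiX|[g [gXA]]].
  by exists 0; rewrite translate0; case: XA.
by rewrite (sidon4_rigid sA XA gXA) translate0.
Qed.

Theorem corollary5 (U : set_system int) (hU : Z_Ramsey 4%N U) : selective U.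
Proof.
have [Ufree _] := hU; split=> // P [Pcover Ptriv _].
have [UU _] := Ufree.
have cofin s := free_ultrafilter_cofinite s Ufree.
have [?|noU] := pselect (exists2 C, P C & U C); [by left|right].
(* Allowing [x = y] makes [r] reflexive, so [all2rel r], which also tests the diagonal, says that a
   set meets each cell at most once. *)
pose r x y := `[< forall C, P C -> C x -> C y -> x = y >].
have [A UA [c Ac]] := Z_Ramsey4_Ramsey (fun X => all2rel r (enum_fset X)) hU.
exists A => // C PC x y [Ax Cx] [Ay Cy]; apply: contrapT => /eqP xy.
have all2relF (X : {fset int}) : x \in X -> y \in X -> ~~ all2rel r (enum_fset X).
  move=> xX yX; apply/negP => /allrelP/(_ x y xX yX)/asboolP/(_ C PC Cx Cy).
  exact/eqP.
(* Two points of [A] in one cell extend to a 4-subset of [A], which is coloured [false]. *)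
have c_false : c = false.
  have [z [Az]] := filter_ex (filterI UA (cofin [:: x; y])).
  rewrite /= !inE !negb_or => /andP[zx zy].
  have [w [Aw]] := filter_ex (filterI UA (cofin [:: x; y; z])).
  rewrite /= !inE !negb_or => /and3P[wx wy wz].
  rewrite -(Ac [fset u in [:: x; y; z; w]]%fset).
    by apply/negbTE/all2relF; rewrite !inE eqxx ?orbT.
  apply: nsubsets_seq => [|u]; last by rewrite !inE => /or4P[] /eqP ->.
  by rewrite /= !inE !negb_or xy ![_ == z]eq_sym ![_ == w]eq_sym zx zy wx wy wz.
(* The cell of [u] is not in [U], so its complement is. *)
have Ur u : U [set v | r u v && (u != v)].
  have : [set: int] u by [].
  rewrite -Pcover => -[K PK Ku].
  have [UK|UK] := in_ultra_setVsetC K UU; first by case: noU; exists K.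
  apply: filterS UK => v /= nKv; apply/andP; split; last first.
    by apply: contra_not_neq nKv => <-.
  apply/asboolP => L PL Lu Lv; case: nKv.
  by rewrite (Ptriv _ _ PK PL) //; exists u.
(* Four points of [A] in distinct cells form a 4-set coloured [true], contradicting [c_false]. *)
have [s [s4 sA]] := filter_pairwise 4 (@ultra_proper _ _ UU) Ur UA.
rewrite pairwise_relI -uniq_pairwise => /andP[rs s_uniq].
have := Ac [fset u in s]%fset; rewrite -s4 c_false => /(_ (nsubsets_seq s_uniq sA)).
have r_refl : reflexive r by move=> u; apply/asboolP.
have r_sym : symmetric r.
  by move=> u v; apply/asboolP/asboolP => h K PK Ku Kv; apply/esym/(h K).
move: rs; rewrite pairwise_all2rel // => /allrelP rs /negP; apply.
by apply/allrelP => u v; rewrite !inE; exact: rs.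
Qed.
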